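(* For every integer $n$ with $|n|\ge 400$, \[ C_n<265.55\,\log|n|\,(\log\log|n|)^2+9.01\,\log\log|n|. \] That is, if $S$ is any set of positive integers with the property $D(n)$, then the number of elements $x\in S$ with $1\le x\le n^2$ is less than the right-hand side.
   Context: Let $n$ be a nonzero integer. A set of positive integers $S$ has the property $D(n)$ if $xy+n$ is a perfect square for all distinct $x,y\in S$. Define $C_n=\sup\{|S\cap[1,n^2]| : S \text{ has the property } D(n)\}$. Here $\log$ is the natural logarithm. *)

(* Defs.v *)
From Stdlib Require Import Reals ZArith List.
Open Scope Z_scope.

Definition positive_set (S : Z -> Prop) : Prop := forall x, S x -> 0 < x.

Definition property_D (n : Z) (S : Z -> Prop) : Prop :=
  forall x y, S x -> S y -> x <> y -> exists k : Z, x * y + n = k * k.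

(* Main.v *)
(* A set with property D(n) occupies at most sqrt p + 4 residue classes modulo
   every prime p not dividing n, because the sums of chi(x y + n) over y in the
   set, chi the quadratic character, have second moment in x at most p times
   the number of classes.  Gallagher's larger sieve over the primes p <= Q not
   dividing n then bounds the set by 2 (sqrt Q + 4) as soon as the product of
   these primes is at least |n| ^ (4 (sqrt Q + 4)).  The central binomial
   coefficient bounds the product of the primes up to Q from below by
   2 ^ (Q / 2) / Q ^ sqrt Q, so sqrt Q = 16 k with |n| <= 2 ^ k is enough: the
   set has fewer than 32 k + 8 elements in [1, n^2], which is O(log |n|). *)
Require Import Defs.
From Stdlib Require Import Reals ZArith List.
From Stdlib Require Import Lra.
From mathcomp Require Import all_boot all_order all_algebra.
From mathcomp Require Import zify ssrZ ring.

(** * Quadratic character of a finite field of odd characteristic *)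

Section QuadraticCharacter.
Set Implicit Arguments.
Unset Strict Implicit.
Import Order.TTheory GRing.Theory Num.Theory.
Local Open Scope ring_scope.

Variable F : finFieldType.
Hypothesis two_neq0 : (2%:R : F) != 0.

(** Zero counts as a square, since x y + n is allowed to vanish. *)
Definition is_square (x : F) : bool := [exists y, x == y ^+ 2].

Definition quad_char (x : F) : int :=
  if x == 0 then 0 else if is_square x then 1 else -1.

Lemma is_squareP x : reflect (exists y, x = y ^+ 2) (is_square x).
Proof. exact: 'exists_eqP. Qed.

Lemma is_square_sqr (y : F) : is_square (y ^+ 2).
Proof. by apply/is_squareP; exists y. Qed.

Lemma is_squareM_square (x y : F) :
  x != 0 -> is_square x -> is_square (x * y) = is_square y.
Proof.
move=> x0 /is_squareP [u xE]; have u0 : u != 0.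
  by apply: contraNneq x0 => u0; rewrite xE u0 expr0n.
apply/is_squareP/is_squareP => -[v vE].
  by exists (v / u); rewrite expr_div_n -vE xE mulrC mulKf // expf_neq0.
by exists (u * v); rewrite exprMn -vE xE.
Qed.

Definition nz_squares : {set F} := [set x | (x != 0) && is_square x].
Definition nonsquares : {set F} := [set x | ~~ is_square x].

(** Squaring is two-to-one on nonzero elements: the fibre over u ^ 2 is {u, - u}, with u and - u
    distinct because 2 is nonzero. *)
Lemma card_nz_squares : (#|nz_squares| * 2 = #|F|.-1)%N.
Proof.
have -> : #|F|.-1 = #|[set~ (0 : F)]| by rewrite cardsC1.
rewrite -[RHS]sum1_card (partition_big (fun x => x ^+ 2) (mem nz_squares)) /=; last first.
  move=> x; rewrite !inE => x0; rewrite expf_neq0 //=; apply: is_square_sqr.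
rewrite -sum_nat_const; apply: eq_bigr => z; rewrite inE => /andP [z0 /is_squareP [u zE]].
have u0 : u != 0 by apply: contraNneq z0 => u0; rewrite zE u0 expr0n.
rewrite sum1dep_card -[RHS](_ : #|[set u; - u]| = _).
  rewrite cards2; suff -> : u != - u by [].
  by rewrite -subr_eq0 opprK -mulr2n -mulr_natl mulf_neq0.
apply: eq_card => x; rewrite !inE zE eqf_sqr.
apply/idP/andP => [/orP [] /eqP ->|[]//]; by rewrite ?oppr_eq0 u0 eqxx ?orbT.
Qed.

Lemma card_nonsquares : #|nonsquares| = #|nz_squares|.
Proof.
have /eqP := cardsC nonsquares.
have -> : ~: nonsquares = 0 |: nz_squares.
  apply/setP=> x; rewrite !inE negbK; case: eqVneq => //= ->.
  by apply/is_squareP; exists 0; rewrite expr0n.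
rewrite cardsU1 inE eqxx /= => /eqP; have := card_nz_squares.
have : (0 < #|F|)%N by apply/card_gt0P; exists 0.
by move: #|nz_squares| #|nonsquares| #|F|; lia.
Qed.

(** Multiplication by a nonsquare x sends nonzero squares injectively into nonsquares. Both sets
    have the same size, so every nonsquare is x times a square, and injectivity excludes x times a
    nonsquare. *)
Lemma is_squareM_nonsquare (x y : F) :
  ~~ is_square x -> y != 0 -> is_square (x * y) = ~~ is_square y.
Proof.
move=> nx y0; case ysq: (is_square y).
  by rewrite mulrC is_squareM_square // (negbTE nx).
have x0 : x != 0 by apply: contraNneq nx => ->; apply/is_squareP; exists 0; rewrite expr0n.
have sub : [set x * z | z in nz_squares] \subset nonsquares.
  apply/subsetP=> _ /imsetP [z + ->]; rewrite !inE => /andP [z0 zsq].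
  by rewrite mulrC is_squareM_square.
have /eqP E : [set x * z | z in nz_squares] == nonsquares.
  by rewrite eqEcard sub card_nonsquares card_imset ?leqnn //; apply: mulfI.
rewrite /=; apply: contraT => nxy; have : x * y \in nonsquares by rewrite inE.
rewrite -E => /imsetP [z + /(mulfI x0) yz]; by rewrite -yz inE ysq andbF.
Qed.

Lemma quad_charM (x y : F) : quad_char (x * y) = quad_char x * quad_char y.
Proof.
rewrite /quad_char mulf_eq0.
case: (boolP (x == 0)) => [_|x0] /=; first by rewrite mul0r.
case: (boolP (y == 0)) => [_|y0] /=; first by rewrite mulr0.
case xsq: (is_square x); first by rewrite is_squareM_square // mul1r.
by rewrite is_squareM_nonsquare ?xsq //; case: (is_square y).
Qed.

Lemma quad_char0 : quad_char 0 = 0.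
Proof. by rewrite /quad_char eqxx. Qed.

Lemma quad_char_square x : is_square x -> x != 0 -> quad_char x = 1.
Proof. by rewrite /quad_char => -> /negbTE ->. Qed.

Lemma quad_char_ge x : -1 <= quad_char x.
Proof. by rewrite /quad_char; case: eqP => // _; case: is_square. Qed.

Lemma sum_quad_char : \sum_x quad_char x = 0.
Proof.
rewrite (bigID is_square) /= [X in _ + X](_ : _ = - (#|nonsquares|%:R)); last first.
  rewrite -sum1_card natr_sum -sumrN; apply: eq_big => [x|x nx]; first by rewrite inE.
  rewrite /quad_char (negbTE nx); case: eqP nx => // -> /negP [].
  by apply/is_squareP; exists 0; rewrite expr0n.
rewrite (bigD1 0) /=; last by apply/is_squareP; exists 0; rewrite expr0n.
rewrite quad_char0 add0r [X in X + _](_ : _ = #|nz_squares|%:R).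
  by rewrite card_nonsquares subrr.
rewrite -sum1_card natr_sum; apply: eq_big => [x|x /andP[sx x0]]; first by rewrite inE andbC.
by rewrite quad_char_square.
Qed.

Lemma sum_quad_char_affine a b : b != 0 -> \sum_x quad_char (a + b * x) = 0.
Proof.
move=> b0; rewrite -[RHS]sum_quad_char [RHS](reindex (fun x => a + b * x)) //.
exists (fun y => (y - a) / b) => x _; first by field.
by field.
Qed.

Lemma sum_quad_char_pair (n y z : F) : n != 0 -> y != 0 -> z != 0 ->
  \sum_x quad_char (x * y + n) * quad_char (x * z + n)
    = #|F|%:R *+ (y == z) - quad_char y * quad_char z.
Proof.
move=> n0 y0 z0.
(* Substitute [t = x * y + n], then invert [t]: up to the square factor [t ^ 2]
   the summand becomes the character of an affine function of [t^-1]. *)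
rewrite (reindex (fun t => (t - n) / y)) /=; last first.
  exists (fun x => x * y + n) => x _; first by rewrite divfK // subrK.
  by rewrite addrK mulfK.
have nzE a : a != 0 -> quad_char (a * a) = 1.
  by move=> a0; rewrite quad_char_square ?mulf_neq0 // -expr2 is_square_sqr.
rewrite (eq_bigr (fun t => quad_char t * quad_char (t * (z / y) + n * (1 - z / y)))); last first.
  by move=> t _; congr (quad_char _ * quad_char _); field.
case: eqVneq => [<-|yz].
  rewrite mulr1n -quad_charM nzE //.
  rewrite (eq_bigr (fun t => (t != 0)%:R)); last first.
    move=> t _; rewrite divff // subrr mulr0 addr0 mulr1 -quad_charM.
    by case: eqVneq => [->|t0]; rewrite ?mul0r ?quad_char0 ?nzE.
  rewrite -natr_sum -big_mkcond /= sum1_card.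
  have <- : #|[set~ (0:F)]| = #|predC1 (0 : F)| by apply: eq_card => x; rewrite !inE.
  rewrite cardsC1 -subn1 natrB //; by apply/card_gt0P; exists 0.
rewrite sub0r (bigD1 0) //= quad_char0 mul0r add0r.
rewrite (eq_bigr (fun t => quad_char (z / y + n * (1 - z / y) * t^-1))); last first.
  move=> t t0; rewrite -quad_charM.
  have -> : t * (t * (z / y) + n * (1 - z / y))
     = t * t * (z / y + n * (1 - z / y) * t^-1) by field; rewrite ?y0 ?t0.
  by rewrite quad_charM nzE // mul1r.
rewrite (reindex_inj invr_inj) /=.
have b0 : n * (1 - z / y) != 0.
  rewrite mulf_neq0 // subr_eq0; apply: contraNneq yz => e.
  by rewrite -[z](divfK y0) -e mul1r.
(* The sum now runs over the nonzero t of a complete affine sum, which vanishes. So it is minus the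
   missing term at t = 0, the character of z / y. *)
have := sum_quad_char_affine (z / y) b0; rewrite (bigD1 0) //= mulr0 addr0.
move/eqP; rewrite addrC addr_eq0 => /eqP E.
rewrite (eq_big (fun t => t != 0) (fun t => quad_char (z / y + n * (1 - z / y) * t))).
- rewrite E; congr (- _).
  by rewrite -[in RHS](divfK y0 z) [in RHS]quad_charM mulrCA -quad_charM nzE ?mulr1.
- by move=> t; rewrite invr_eq0.
- by move=> t _; rewrite invrK.
Qed.

(* Vinogradov's bilinear estimate, in its second-moment form. *)
Lemma second_moment (n : F) (B : {set F}) : n != 0 -> 0 \notin B ->
  \sum_x (\sum_(y in B) quad_char (x * y + n)) ^+ 2 <= (#|F| * #|B|)%:R.
Proof.
move=> n0 B0; have Bnz y : y \in B -> y != 0.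
  by move=> yB; apply: contraNneq B0 => <-.
rewrite (eq_bigr (fun x => \sum_(y in B) \sum_(z in B)
   quad_char (x * y + n) * quad_char (x * z + n))); last first.
  by move=> x _; rewrite expr2 big_distrlr.
rewrite exchange_big /=.
rewrite (eq_bigr (fun y => #|F|%:R - quad_char y * \sum_(z in B) quad_char z)); last first.
  move=> y yB; rewrite exchange_big /=.
  rewrite (eq_bigr (fun z => #|F|%:R *+ (y == z) - quad_char y * quad_char z)); last first.
    by move=> z zB; rewrite sum_quad_char_pair // Bnz.
  rewrite sumrB -mulr_sumr; congr (_ - _).
  rewrite (bigD1 y) //= eqxx big1 ?addr0 // => z /andP[_ zy].
  by rewrite eq_sym (negbTE zy).
(* The total is |F| |B| minus the square of the character sum over [B], which is dropped. *)
rewrite sumrB -mulr_suml sumr_const -mulrnA.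
by rewrite lerBlDr lerDl -expr2 sqr_ge0.
Qed.

(** Keeping only the rows x in [B] of the second moment gives k (k - 3) ^ 2 <= |F| k. The 4 is made
    of 1 for the removed element 0, 2 for the diagonal term, which may be -1 instead of 1, and 1 for
    a term that vanishes. *)
Lemma square_set_card (n : F) (A : {set F}) : n != 0 ->
  {in A &, forall x y, x != y -> is_square (x * y + n)} ->
  ((#|A| - 4) ^ 2 <= #|F|)%N.
Proof.
move=> n0 sqA; set B := A :\ 0; set k := #|B|.
have B0 : 0 \notin B by rewrite !inE eqxx.
have cA : (#|A| <= k.+1)%N by rewrite (cardsD1 0 A) -/B -/k -add1n leq_add2r leq_b1.
case: (leqP k 3) => [k3|k3]; first by have -> : (#|A| - 4 = 0)%N by lia.
(* All terms of the sum at [x] are 1, except possibly those at [y = x] (at least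
   -1) and at [y = - n / x] (zero). *)
have T x : x \in B -> (k - 3)%N%:R <= \sum_(y in B) quad_char (x * y + n).
  move=> xB; have x0 : x != 0 by move: xB; rewrite !inE => /andP[].
  pose y0 := - n / x.
  have step y : y \in B -> 1 - (y == x)%:R *+ 2 - (y == y0)%:R <= quad_char (x * y + n).
    move=> yB; have := quad_char_ge (x * y + n).
    case: (eqVneq y x) => [_|yx] ge.
      by apply: le_trans ge; case: (y == y0).
    have sq : is_square (x * y + n).
      by apply: sqA; [move: xB | move: yB | rewrite eq_sym]; rewrite ?inE // => /andP[].
    case: (eqVneq y y0) => [-> | yy0].
      by rewrite /y0 mulrC divfK // addNr quad_char0.
    rewrite quad_char_square // addr_eq0; apply: contra yy0 => /eqP e.
    by rewrite /y0 -e [x * y]mulrC mulfK.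
  apply: le_trans (ler_sum _ step).
  rewrite !sumrB sumr_const -/k sumrMnl.
  have sum1 (u : F) : \sum_(i in B) (i == u)%:R <= 1 :> int.
    rewrite -natr_sum -big_mkcondr /= sum1_card (ler_nat _ _ 1).
    by rewrite -(card1 u) subset_leq_card //; apply/subsetP=> z; rewrite !inE => /andP[].
  rewrite natrB; last exact: ltnW.
  rewrite (_ : 3%:R = 1 *+ 2 + 1 :> int) // opprD addrA.
  by apply: lerB; [apply: lerB => //; apply: ler_wMn2r; apply: sum1 | apply: sum1].
have := second_moment n0 B0.
rewrite (bigID (mem B)) /=.
have : 0 <= \sum_(i | i \notin B) (\sum_(y in B) quad_char (i * y + n)) ^+ 2.
  by apply: sumr_ge0 => i _; apply: sqr_ge0.
have : (k * (k - 3) ^ 2)%N%:R <= \sum_(i in B) (\sum_(y in B) quad_char (i * y + n)) ^+ 2.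
  rewrite natrM -/k mulr_natl -sumr_const; apply: ler_sum => i iB.
  by rewrite natrX lerXn2r ?nnegrE ?T ?ler0n // (le_trans _ (T _ iB)).
move=> h1 h2 h3; have : ((k * (k - 3) ^ 2)%N%:R : int) <= (#|F| * k)%:R.
  apply: le_trans h3; apply: (le_trans h1); by rewrite lerDl.
rewrite ler_nat mulnC leq_pmul2r; last exact: leq_trans k3.
by apply: leq_trans; rewrite leq_exp2r //; apply: (leq_sub2r 4 cA).
Qed.

End QuadraticCharacter.

(** * Gallagher's larger sieve *)

Section LargerSieve.
Local Open Scope nat_scope.
Set Implicit Arguments.
Unset Strict Implicit.

Lemma sum_sqr_le (I : Type) (t : seq I) (g : I -> nat) :
  (\sum_(i <- t) g i) ^ 2 <= size t * \sum_(i <- t) g i ^ 2.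
Proof.
rewrite -(leq_pmul2l (ltn0Sn 1)).
have -> : 2 * (\sum_(i <- t) g i) ^ 2 = \sum_(i <- t) \sum_(j <- t) 2 * (g i * g j).
  rewrite -mulnn big_distrlr /= big_distrr /=.
  by apply: eq_bigr => i _; rewrite big_distrr.
have -> : 2 * (size t * \sum_(i <- t) g i ^ 2)
    = \sum_(i <- t) \sum_(j <- t) (g i ^ 2 + g j ^ 2).
  rewrite [RHS](eq_bigr (fun i => size t * g i ^ 2 + \sum_(j <- t) g j ^ 2)).
    rewrite big_split /= -big_distrr /= big_const_seq count_predT iter_addn_0; lia.
  by move=> i _; rewrite big_split /= big_const_seq count_predT iter_addn_0 mulnC.
by apply: leq_sum => i _; apply: leq_sum => j _; apply: nat_Cauchy.
Qed.

(** Cauchy-Schwarz for the fibre sizes of [f]: they add up to [size s], and their squares add up to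
    the number of ordered pairs, diagonal included, with equal images. *)
Lemma collisions_ge (I : Type) (T : eqType) (f : I -> T) (s : seq I) :
  size s ^ 2 <= size (undup (map f s)) * \sum_(x <- s) \sum_(y <- s) (f x == f y).
Proof.
set t := undup _.
have tE x : x \in map f s -> \sum_(c <- t) (x == c) = 1.
  move=> xs; rewrite -[RHS](_ : count_mem x t = 1).
    by rewrite -big_mkcond /= sum1_count; apply: eq_count => c; rewrite /= eq_sym.
  by rewrite count_uniq_mem ?undup_uniq // mem_undup xs.
have onS (g : T -> nat) : \sum_(x <- s) g (f x) = \sum_(z <- map f s) g z.
  by rewrite big_map.
have -> : size s = \sum_(c <- t) \sum_(x <- s) (f x == c).
  rewrite exchange_big /= (onS (fun z => \sum_(c <- t) (z == c))).
  rewrite big_seq (eq_bigr (fun=> 1)); last by move=> z /tE.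
  by rewrite -big_seq big_const_seq count_predT iter_addn_0 mul1n size_map.
apply: leq_trans (sum_sqr_le _ _) _; rewrite leq_mul2l; apply/orP; right.
rewrite (eq_bigr (fun c => \sum_(x <- s) \sum_(y <- s) (f x == c) * (f y == c))); last first.
  by move=> c _; rewrite -mulnn big_distrlr.
rewrite exchange_big /= (onS (fun z => \sum_(y <- s) (z == f y))).
rewrite (onS (fun z => \sum_(c <- t) \sum_(y <- s) (z == c) * (f y == c))).
rewrite big_seq [leqRHS]big_seq; apply: leq_sum => z zs.
rewrite exchange_big /=; apply: leq_sum => y _.
rewrite -[leqRHS]muln1 -(tE z zs) big_distrr /=; apply: leq_sum => c _.
by case: eqP => [->|]; rewrite ?mul0n // mul1n muln1 eq_sym.
Qed.

Lemma logn_prod (I : Type) (r : seq I) (P : pred I) (F : I -> nat) p :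
  (forall i, P i -> 0 < F i) ->
  logn p (\prod_(i <- r | P i) F i) = \sum_(i <- r | P i) logn p (F i).
Proof.
move=> F0; elim: r => [|i r IH]; first by rewrite !big_nil logn1.
by rewrite !big_cons; case: ifP => // Pi; rewrite lognM ?IH ?F0 // prodn_cond_gt0.
Qed.

Lemma partn_leq pi n : 0 < n -> n`_pi <= n.
Proof. by move=> n0; rewrite dvdn_leq // dvdn_part. Qed.

(** The part of [D] supported on the selected p up to [Q] is at most [D], and each such p enters it
    with exponent at least [e]. *)
Lemma prod_primes_exp_le (P : pred nat) (Q e D : nat) :
  0 < D -> (forall p, P p -> p <= Q -> e <= logn p D) -> (forall p, P p -> 0 < p) ->
  (\prod_(0 <= p < Q.+1 | P p) p) ^ e <= D.
Proof.
move=> D0 eP P0; pose pi : nat_pred := [pred p | P p && (p <= Q)].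
apply: leq_trans (partn_leq pi D0).
(* The range must contain every prime factor of [D] and every p up to [Q]. *)
rewrite (@widen_partn (maxn D Q)) ?leq_maxl //.
rewrite (big_morph (expn^~ e) (fun a b => expnMn a b e) (exp1n e)).
rewrite [leqRHS](big_cat_nat (n := Q.+1)) //= ?ltnS ?leq_maxr //.
rewrite -[leqLHS]muln1; apply: leq_mul; last first.
  by apply: prodn_cond_gt0 => p /andP[/P0]; rewrite expn_gt0 => ->.
rewrite big_nat_cond [leqRHS]big_nat_cond.
rewrite [leqRHS](eq_bigl (fun p => (0 <= p < Q.+1) && P p)); last first.
  by move=> p; rewrite inE ltnS; case: (P p); case: (p <= Q).
apply: leq_prod => p /andP[/andP[_ pQ] Pp].
by rewrite leq_pexp2l ?P0 // eP.
Qed.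

(* Gallagher's argument: each sieving prime divides many of the differences
   [x - y], while their product is at most [X ^ (m * (m - 1))]. *)
Lemma larger_sieve (s : seq nat) (X V Q : nat) (P : pred nat) :
  uniq s -> (forall x, x \in s -> 0 < x <= X) ->
  (forall p, P p -> prime p) ->
  (forall p, P p -> p <= Q -> size (undup [seq x %% p | x <- s]) <= V) ->
  (\prod_(0 <= p < Q.+1 | P p) p) ^ (size s ^ 2 - V * size s)
    <= X ^ (V * (size s * (size s).-1)).
Proof.
move=> us sX primeP resV; set m := size s.
(* Subtraction is truncated, so one summand is zero and [dist] is the absolute difference. *)
pose dist x y := (x - y) + (y - x).
pose D := \prod_(x <- s) \prod_(y <- s | y != x) dist x y.
have dist0 x y : y != x -> 0 < dist x y by rewrite /dist; lia.
have D0 : 0 < D by do 2!(apply: prodn_cond_gt0 => ? ?); apply: dist0.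
have cardD x : x \in s -> count (fun y => y != x) s = m.-1.
  move=> xs; have := count_predC (pred1 x) s; rewrite count_uniq_mem // xs.
  by rewrite -/m => <-.
have DX : D <= X ^ (m * m.-1).
  rewrite mulnC expnM; apply: leq_trans (_ : \prod_(x <- s) X ^ m.-1 <= _); last first.
    by rewrite big_const_seq count_predT iter_muln_1.
  rewrite /D big_seq [leqRHS]big_seq; apply: leq_prod => x xs.
  rewrite -(cardD x xs) -iter_muln_1 -big_const_seq.
  rewrite [leqLHS]big_seq_cond [leqRHS]big_seq_cond; apply: leq_prod => y /andP[ys _].
  by have := sX _ xs; have := sX _ ys; rewrite /dist; lia.
(* Working with [D ^ V] avoids dividing the collision bound by [V]. *)
rewrite (mulnC V (m * _)) expnM; apply: (@leq_trans (D ^ V)); last first.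
  by move: V {resV} => [|V]; rewrite ?expn0 // leq_exp2r.
apply: prod_primes_exp_le; first by rewrite expn_gt0 D0.
  move=> p Pp pQ; have pp := primeP p Pp.
  rewrite lognX leq_subLR.
  have := collisions_ge (fun x => x %% p) s; rewrite -/m.
  set C := \sum_(x <- s) _ => CV.
  apply: leq_trans CV _; apply: (@leq_trans (V * C)); first by rewrite leq_mul2r resV ?orbT.
  rewrite -mulnDr leq_mul2l; apply/orP; right.
  rewrite /D logn_prod; last by move=> x _; apply: prodn_cond_gt0 => y; apply: dist0.
  rewrite /m -sum1_size -big_split /= /C big_seq [leqRHS]big_seq.
  apply: leq_sum => x xs; rewrite logn_prod; last exact: dist0.
  (* The pair (x, x) is paid for by the summand [m]; for any other pair with equal residues p
     divides [dist x y]. *)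
  rewrite (bigD1_seq x) //= eqxx leq_add2l; apply: leq_sum => y yx.
  case: eqP => // e; rewrite -(pfactor_dvdn 1) ?dist0 // expn1.
  case: (leqP x y) => xy.
    rewrite /dist (eqP (_ : x - y == 0)) ?subn_eq0 // add0n -eqn_mod_dvd //; exact/eqP.
  rewrite /dist (eqP (_ : y - x == 0)) ?subn_eq0 1?ltnW // addn0 -eqn_mod_dvd 1?ltnW //; exact/eqP.
by move=> p /primeP /prime_gt0.
Qed.

(** For m = [size s] at least 2 V, comparing exponents of N gives 4 V m (m - V) <= 2 V m (m - 1),
    hence m <= 2 V - 1, a contradiction. *)
Lemma larger_sieve_size (s : seq nat) (N V Q : nat) (P : pred nat) :
  1 < N -> 0 < V -> uniq s -> (forall x, x \in s -> 0 < x <= N ^ 2) ->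
  (forall p, P p -> prime p) ->
  (forall p, P p -> p <= Q -> size (undup [seq x %% p | x <- s]) <= V) ->
  N ^ (4 * V) <= \prod_(0 <= p < Q.+1 | P p) p ->
  size s < 2 * V.
Proof.
move=> N1 V0 us sN primeP resV big; have := larger_sieve us sN primeP resV.
set m := size s; have [|mV] := leqP (2 * V) m; last by [].
move=> Vm; have e0 : 0 < m ^ 2 - V * m by nia.
have := big; rewrite -(leq_exp2r _ _ e0) => /leq_trans H /H.
rewrite -!expnM leq_exp2l // => h; exfalso; move: h; nia.
Qed.

End LargerSieve.

(** * Chebyshev-type lower bound for the product of primes *)

Section Chebyshev.
Local Open Scope nat_scope.
Set Implicit Arguments.
Unset Strict Implicit.

Lemma central_bin_ge m : 2 ^ m <= 'C(m.*2, m).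
Proof.
elim: m => [|m IH]; first by rewrite bin0.
rewrite doubleS binS expnS mul2n -addnn.
apply: leq_add; apply: (leq_trans IH).
  by rewrite binS leq_addl.
case: m {IH} => [|m]; first by rewrite !bin0.
by rewrite [leqRHS]binS leq_addr.
Qed.

(** By Legendre's formula the exponent is the sum over i of floor(2m / p^i) - 2 floor(m / p^i). Each
    term is at most 1 and vanishes once p^i > 2m. *)
Lemma logn_central_bin p m : prime p ->
  logn p 'C(m.*2, m) <= trunc_log p m.*2.
Proof.
move=> pp; have p1 := prime_gt1 pp.
case: (posnP m) => [->|m0]; first by rewrite bin0 logn1.
move: m m0 => n n0; set t := trunc_log p n.*2.
have nn : n <= n.*2 by rewrite -addnn leq_addr.
have := bin_fact nn; have -> : n.*2 - n = n by rewrite -addnn addnK.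
move/(congr1 (logn p)); rewrite !lognM ?muln_gt0 ?fact_gt0 ?bin_gt0 // addnn.
(* Legendre's sums for both factorials are put on one range; the added terms are zero. *)
have E k : k <= n.*2 -> logn p k`! = \sum_(1 <= i < n.*2.+1) k %/ p ^ i.
  move=> kn; rewrite logn_fact // [RHS](big_cat_nat (n := k.+1)) //= ?ltnS //.
  rewrite [X in _ + X]big_nat_cond [X in _ + X]big1 ?addn0 // => i /andP[/andP[ki _] _].
  by rewrite divn_small // (leq_trans ki) // ltnW // ltn_expl.
rewrite !E // => H.
have tn : t <= n.*2.
  rewrite -ltnS (leq_trans (ltn_expl t p1)) // ltnW // ltnS.
  by apply: trunc_logP; rewrite // double_gt0.
rewrite -(leq_add2r (\sum_(1 <= i < n.*2.+1) n %/ p ^ i).*2) H.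
rewrite -[X in _ <= _ + X]mul2n big_distrr /=.
(* Writing [t] as a count of indices allows a termwise comparison. *)
rewrite -[X in X + _](_ : \sum_(1 <= i < n.*2.+1) (i <= t) = t); last first.
  rewrite (big_cat_nat (n := t.+1)) //= ?ltnS //.
  rewrite [X in _ + X]big_nat_cond [X in _ + X]big1 ?addn0; last first.
    by move=> i /andP[/andP[ti _] _]; rewrite leqNgt ti.
  rewrite big_nat_cond (eq_bigr (fun=> 1)); last by move=> i /andP[/andP[_]]; rewrite ltnS => ->.
  by rewrite -big_nat_cond sum_nat_const_nat muln1 subn1.
rewrite -big_split /= big_nat_cond [leqRHS]big_nat_cond.
apply: leq_sum => i /andP[/andP[i0 _] _].
have pi0 : 0 < p ^ i by rewrite expn_gt0 prime_gt0.
case: (leqP i t) => it /=.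
  rewrite -ltnS ltn_divLR //; have := ltn_ceil n pi0; nia.
rewrite divn_small //; apply: leq_trans (trunc_log_ltn _ p1) _.
by rewrite leq_pexp2l // prime_gt0.
Qed.

(** In the central binomial coefficient a prime above r has exponent at most 1, since its square
    exceeds r ^ 2 = 2m. Each of the at most r smaller primes contributes a power at most r ^ 2. *)
Lemma primorial_ge r m : m.*2 = r ^ 2 ->
  2 ^ m <= (\prod_(0 <= p < (r ^ 2).+1 | prime p) p) * (r ^ 2) ^ r.
Proof.
move=> mr; apply: leq_trans (central_bin_ge m) _; rewrite mr.
set b := 'C(_, _); have b0 : 0 < b by rewrite /b bin_gt0 -mr -addnn leq_addr.
case: (posnP r) => [r0|r0].
  have m0 : m = 0 by move: mr; rewrite r0; lia.
  by rewrite /b r0 m0 bin0 muln_gt0 andbT prodn_cond_gt0 // => p /prime_gt0.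
have logb p : prime p -> logn p b <= trunc_log p (r ^ 2).
  by rewrite /b -mr; apply: logn_central_bin.
rewrite -{1}(partn_pi b0) (@widen_partn (maxn b (r ^ 2))) ?leq_maxl //.
have -> : \prod_(0 <= p < (maxn b (r ^ 2)).+1 | p \in \pi(b)) p ^ logn p b
   = \prod_(0 <= p < (r ^ 2).+1 | prime p) p ^ logn p b.
  rewrite big_mkcond [RHS]big_mkcond /=.
  rewrite [LHS](big_cat_nat (n := (r ^ 2).+1)) //= ?ltnS ?leq_maxr //.
  have E p : (if p \in \pi(b) then p ^ logn p b else 1) = if prime p then p ^ logn p b else 1.
    rewrite -[p \in _]logn_gt0; case pp: (prime p); last by rewrite lognE pp.
    by case: posnP => [->|].
  rewrite [X in _ * X]big_nat_cond [X in _ * X]big1 ?muln1; first by apply: eq_bigr => p _.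
  move=> p /andP[/andP[rp _] _]; rewrite E; case: ifP => // pp.
  have := logb p pp; have -> : trunc_log p (r ^ 2) = 0; last by case: (logn p b).
  by apply/eqP; rewrite trunc_log_eq0; apply/orP; right; move: rp; lia.
(* One factor r ^ 2 is given to each integer from 1 to r, prime or not, so that the products compare
   factor by factor. *)
have -> : (r ^ 2) ^ r = \prod_(0 <= p < (r ^ 2).+1) (if 0 < p <= r then r ^ 2 else 1).
  rewrite -big_mkcond /= (big_cat_nat (n := r.+1)) //= ?ltnS; last by nia.
  rewrite [X in _ * X]big_nat_cond [X in _ * X]big1 ?muln1; last first.
    by move=> p /andP[/andP[rp _] /andP[_ pr]]; move: rp; rewrite ltnNge pr.
  rewrite big_ltn_cond //= big_nat_cond (eq_bigl (fun p => (1 <= p < r.+1) && true)).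
    by rewrite -big_nat_cond prod_nat_const_nat subn1.
  by move=> p; rewrite ltnS; case: (0 < p <= r).
rewrite [X in X * _]big_mkcond /= -big_split /= [leqLHS]big_mkcond /=.
apply: leq_prod => p _; case: ifP => pp; last by case: ifP => // _; rewrite mul1n expn_gt0 r0.
have p1 := prime_gt1 pp; have p0 := prime_gt0 pp; rewrite p0 /=.
have r20 : 0 < r ^ 2 by rewrite expn_gt0 r0.
case: (leqP p r) => pr.
  rewrite (leq_trans _ (leq_pmull _ p0)) //.
  by apply: (leq_trans _ (trunc_logP p1 r20)); rewrite leq_pexp2l // logb.
rewrite muln1 -[leqRHS]expn1 leq_pexp2l // (leq_trans (logb p pp)) //.
rewrite -ltnS -(ltn_exp2l _ _ p1) (leq_ltn_trans (trunc_logP p1 r20)) //.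
by rewrite ltn_exp2r.
Qed.

Lemma prod_prime_divisors_le (n Q : nat) : 0 < n ->
  \prod_(0 <= p < Q.+1 | prime p && (p %| n)) p <= n.
Proof.
move=> n0; rewrite -[leqLHS]expn1.
apply: (@prod_primes_exp_le (fun p => prime p && (p %| n))) => // p /andP[pp pn].
  by rewrite -pfactor_dvdn.
exact: prime_gt0.
Qed.

(** The primes dividing n have product at most n, so discarding them costs at most that factor. *)
Lemma primorial_coprime_ge r m n : m.*2 = r ^ 2 -> 0 < n ->
  2 ^ m <= (\prod_(0 <= p < (r ^ 2).+1 | prime p && ~~ (p %| n)) p) * n * (r ^ 2) ^ r.
Proof.
move=> mr n0; apply: leq_trans (primorial_ge mr) _.
rewrite leq_mul2r; apply/orP; right.
rewrite (bigID (fun p => p %| n)) /= mulnC leq_mul2l.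
by rewrite prod_prime_divisors_le ?orbT.
Qed.

End Chebyshev.

(** * Sieving a set with property D(n) *)

Section DiophantineSets.
Import GRing.Theory Num.Theory.
Local Open Scope nat_scope.
Set Implicit Arguments.
Unset Strict Implicit.

Lemma residues_card (n : int) (s : seq nat) (p : nat) : prime p ->
  (n%:~R : 'F_p)%R != 0%R ->
  {in s &, forall x y, x != y -> exists k : int, (x%:Z * y%:Z + n = k * k)%R} ->
  (size (undup [seq x %% p | x <- s]) - 4) ^ 2 <= p.
Proof.
move=> pp n0 sD; pose f (x : nat) : 'F_p := (x%:R)%R.
have fE (x : nat) : val (f x) = x %% p by exact: (val_Fp_nat pp).
have -> : [seq x %% p | x <- s] = map val (map f s).
  by rewrite -map_comp; apply: eq_map => x; rewrite /= fE.
rewrite undup_map_inj ?size_map; last exact: val_inj.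
pose A := [set c in map f s].
have -> : size (undup (map f s)) = #|A|.
  rewrite -(card_uniqP (undup_uniq _)); apply: eq_card => c.
  by rewrite inE mem_undup.
(* The character argument needs odd p; for p = 2 there are at most 2 classes and the truncated
   difference is 0. *)
have [p2|p2] := eqVneq p 2.
  have := max_card (mem A); rewrite card_Fp // => Ap.
  by have -> : #|A| - 4 = 0 by move: Ap; move: #|A|; lia.
rewrite -[leqRHS](card_Fp pp); apply: (@square_set_card 'F_p _ n%:~R%R) => //.
  rewrite -(dvdn_pcharf (pchar_Fp pp)) dvdn_prime2 //.
move=> x y; rewrite !inE => /mapP[u us ->] /mapP[v vs ->] uv.
have [|k kE] := sD u v us vs; first by apply: contraNneq uv => ->.
apply/is_squareP; exists (k%:~R)%R.
by rewrite expr2 -intrM -kE intrD intrM -!pmulrn.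
Qed.

Lemma diophantine_set_size (n : int) (s : seq nat) (k : nat) :
  1 < `|n| -> `|n| <= 2 ^ k -> 5 <= k ->
  uniq s -> (forall x, x \in s -> 0 < x <= `|n| ^ 2) ->
  {in s &, forall x y, x != y -> exists k : int, (x%:Z * y%:Z + n = k * k)%R} ->
  size s < 32 * k + 8.
Proof.
move=> n1 nk k5 us sn sD; set N := `|n| in n1 nk sn.
pose r := 16 * k; pose m := 128 * k ^ 2; pose V := r + 4.
have N0 : 0 < N by lia.
have mr : m.*2 = r ^ 2 by rewrite /m /r; lia.
have -> : 32 * k + 8 = 2 * V by rewrite /V /r; lia.
pose P p := prime p && ~~ (p %| N).
apply: (@larger_sieve_size s N V (r ^ 2) P) => //.
- by rewrite /V addn_gt0 orbT.
- by move=> p /andP[].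
- move=> p /andP[pp pn] pr.
  have n0 : (n%:~R : 'F_p)%R != 0%R.
    apply: contra pn; rewrite /N (dvdn_pcharf (pchar_Fp pp)).
    case: (n) => j /=; first by rewrite -pmulrn.
    by rewrite NegzE mulrNz oppr_eq0 -pmulrn.
  have := leq_trans (residues_card pp n0 sD) pr.
  by rewrite leq_exp2r // /V; lia.
have := primorial_coprime_ge mr N0.
set Pi := \prod_(_ <= _ < _ | _) _ => H.
(* This uses r = 16 k <= 2 ^ (k + 4). *)
have rk : (r ^ 2) ^ r <= 2 ^ (2 * r * (k + 4)).
  rewrite -expnM [2 * r * _]mulnC [leqRHS]expnM.
  rewrite leq_exp2r ?muln_gt0 //; last by rewrite /r; lia.
  by rewrite expnD mulnC leq_mul //; apply/ltnW/ltn_expl.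
have : 2 ^ m <= Pi * (2 ^ k * 2 ^ (2 * r * (k + 4))).
  by apply: leq_trans H _; rewrite -mulnA leq_mul2l leq_mul ?orbT.
rewrite -expnD => H2.
have NV : N ^ (4 * V) <= 2 ^ (k * (4 * V)).
  by rewrite [leqRHS]expnM leq_exp2r // /V; lia.
apply: leq_trans NV _.
rewrite -(leq_pmul2r (expn_gt0 2 (k + 2 * r * (k + 4)))) //.
apply: leq_trans _ H2; rewrite -expnD leq_exp2l //.
(* The exponents require 96 k ^ 2 + 145 k <= 128 k ^ 2, which is where k >= 5 is needed. *)
rewrite /V /r /m; nia.
Qed.

End DiophantineSets.

(** * Comparison with the stated logarithmic bound *)

Section LogarithmicBound.
Local Open Scope R_scope.

Lemma exp_3_lt_400 : exp 3 < 400.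
Proof.
have -> : 3 = 1 + 1 + 1 by lra.
rewrite !exp_plus; have := exp_le_3; have := exp_pos 1; nra.
Qed.

(** Since ln 2 > 1/2, the size is below 64 ln N + 40. From N >= 400 come ln N > 3 and ln (ln N) > 1,
    so 265.55 ln N alone already exceeds this. *)
Lemma log_bound (N : R) (k m : nat) : 400 <= N -> 2 ^ k < N -> (m < 32 * k.+1 + 8)%N ->
  INR m < 265.55 * ln N * (ln (ln N)) ^ 2 + 9.01 * ln (ln N).
Proof.
move=> N400 kN mk.
have L3 : 3 < ln N.
  rewrite -(ln_exp 3); apply: ln_increasing; first exact: exp_pos.
  by have := exp_3_lt_400; lra.
have LL1 : 1 < ln (ln N).
  rewrite -(ln_exp 1); apply: ln_increasing; first exact: exp_pos.
  by have := exp_le_3; lra.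
have kL : INR k * ln 2 < ln N.
  rewrite -ln_pow; last lra.
  by apply: ln_increasing => //; apply: pow_lt; lra.
have : (m < 32 * S k + 8)%coq_nat by lia.
move/lt_INR; rewrite plus_INR mult_INR (S_INR k) (INR_IZR_INZ 32) (INR_IZR_INZ 8) /= => mL.
have kL2 : INR k < 2 * ln N by have := ln_lt_2; have := pos_INR k; nra.
have LL2 : 1 < ln (ln N) ^ 2 by nra.
have : ln N * 1 < ln N * ln (ln N) ^ 2 by apply: Rmult_lt_compat_l; lra.
lra.
Qed.

Lemma INR_expn (b k : nat) : INR (expn b k) = INR b ^ k.
Proof. by elim: k => [|k IH] //; rewrite expnS mult_INR IH. Qed.

End LogarithmicBound.

(** * Passage from lists of integers to sequences of naturals *)

Lemma mem_In (T : eqType) (x : T) (s : seq T) : x \in s -> In x s.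
Proof.
by elim: s => //= y s IH; rewrite in_cons => /orP[/eqP ->|/IH]; [left|right].
Qed.

Lemma NoDup_uniq (T : eqType) (s : seq T) : NoDup s -> uniq s.
Proof.
elim=> //= x t nx _ ->; rewrite andbT.
by apply/negP => /mem_In.
Qed.

Delimit Scope Z_scope with Z.
Delimit Scope R_scope with R.

(* |S ∩ [1, n^2]| < bound, expressed as: every duplicate-free list of
   elements of S ∩ [1, n^2] has length < bound. *)
Theorem theorem3 (n : Z) (hn : (400 <= Z.abs n)%Z)
  (S : Z -> Prop) (hpos : positive_set S) (hD : property_D n S)
  (l : list Z) (hnd : NoDup l)
  (hl : forall x, In x l -> S x /\ (1 <= x <= n * n)%Z) :
  (INR (length l) <
   265.55 * ln (IZR (Z.abs n)) * (ln (ln (IZR (Z.abs n)))) ^ 2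
   + 9.01 * ln (ln (IZR (Z.abs n))))%R.
Proof.
pose N := Z.abs_nat n; pose s := List.map Z.to_nat l.
have NE : IZR (Z.abs n) = INR N by rewrite INR_IZR_INZ; congr IZR; rewrite /N; lia.
have N400 : (400 <= N)%coq_nat by rewrite /N; lia.
have sP x : x \in s -> exists z, [/\ In z l, S z, x = Z.to_nat z & (1 <= z <= n * n)%Z].
  by move=> /mem_In /in_map_iff [z [<- zl]]; have [Sz zn] := hl z zl; exists z.
have us : uniq s.
  have hl' z : In z l -> (0 <= z)%Z by move=> /hl [_]; lia.
  apply: NoDup_uniq; apply: NoDup_map_NoDup_ForallPairs hnd => x y xl yl.
  by move: (hl' _ xl) (hl' _ yl) => x0 y0; apply: Z2Nat.inj.
have N1 : (1 < N)%N by lia.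
(* The least k with N <= 2 ^ k serves twice: this bound feeds the sieve, and 2 ^ (k - 1) < N makes k
   logarithmic in N. *)
have /andP [kN Nk] := up_log_bounds (isT : (1 < 2)%N) N1.
move: kN Nk; set k := up_log 2 N => kN Nk.
have k5 : (4 < k)%N.
  rewrite leqNgt; apply/negP => k5; have : (N <= 2 ^ 4)%N by apply: leq_trans Nk _; rewrite leq_exp2l.
  by move/leP; have -> : (2 ^ 4 = 16)%N by []; lia.
have nN : absz (int_of_Z n) = N by rewrite /N; lia.
have size_s : (size s < 32 * k + 8)%N.
  apply: (@diophantine_set_size (int_of_Z n)); rewrite ?nN //.
    by move=> x /sP [z [_ _ -> zn]]; rewrite /N; nia.
  move=> x y /sP [u [_ Su -> un]] /sP [v [_ Sv -> vn]] uv.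
  have [|w wE] := hD u v Su Sv; first by move=> e; rewrite e eqxx in uv.
  by exists (int_of_Z w); nia.
rewrite NE; apply: (@log_bound _ k.-1).
- have -> : 400%R = INR 400 by rewrite INR_IZR_INZ.
  exact: le_INR.
- have -> : 2%R = INR 2 by rewrite INR_IZR_INZ.
  by rewrite -INR_expn; apply: lt_INR; apply/ltP.
move: size_s; rewrite /s size_map; have -> : size l = length l by [].
by rewrite prednK // (leq_trans _ k5).
Qed.
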